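(* Let $K$ be an elementary abelian $2$-group and $Q$ a simple Steiner loop. Then there is no nonflexible C-loop $C$ with nucleus $N(C)\cong K$ and $C/N(C)\cong Q$.
   Context: A C-loop is a loop satisfying $x(y\cdot yz) = (xy\cdot y)z$. A loop is flexible if it satisfies $x\cdot yx = xy\cdot x$, and nonflexible otherwise. A Steiner loop is an inverse property loop of exponent two; equivalently, a commutative loop satisfying $x\cdot xy=y$. A loop is simple if it has no normal subloops other than the trivial subloop and itself. The nucleus $N(C)$ of a loop $C$ is the set of all $a\in C$ with $a(xy)=(ax)y$, $x(ay)=(xa)y$ and $x(ya)=(xy)a$ for all $x,y\in C$; in a C-loop it is a normal subloop. *)

(* Defs.v *)
From HB Require Import structures.
From mathcomp Require Import all_boot.
From mathcomp Require Import boolp classical_sets.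

Set Implicit Arguments.
Unset Strict Implicit.
Unset Printing Implicit Defensive.

Import Algebra.
Local Open Scope classical_set_scope.
Local Open Scope group_scope.

(** Loops: unital magmas in which [a * x = b] and [y * a = b] have the unique
    solutions [x = ldiv a b] and [y = rdiv b a]. *)

HB.mixin Record UMagma_isLoop L of UMagma L := {
  ldiv : L -> L -> L;
  rdiv : L -> L -> L;
  mulKldiv : forall x y : L, x * ldiv x y = y;
  ldivKmul : forall x y : L, ldiv x (x * y) = y;
  rdivKmul : forall x y : L, rdiv y x * x = y;
  mulKrdiv : forall x y : L, rdiv (y * x) x = y
}.

#[short(type="loopType")]
HB.structure Definition Loop := {L of UMagma L & UMagma_isLoop L}.

HB.mixin Record Loop_isCLoop L of Loop L := {
  cloopE : forall x y z : L, x * (y * (y * z)) = ((x * y) * y) * z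
}.

#[short(type="cloopType")]
HB.structure Definition CLoop := {L of Loop L & Loop_isCLoop L}.

Definition isomorphic (A B : magmaType) : Prop :=
  exists f : {multiplicative A -> B}, bijective f.

Definition elementary_abelian2 (K : groupType) : Prop :=
  (forall x y : K, commute x y) /\ (forall x : K, x ^+ 2 = 1).

Definition flexible (L : loopType) : Prop :=
  forall x y : L, x * (y * x) = (x * y) * x.

Definition inverse_property (L : loopType) : Prop :=
  forall x : L, exists x' : L,
    forall y : L, x' * (x * y) = y /\ (y * x) * x' = y.

Definition steiner (L : loopType) : Prop :=
  inverse_property L /\ forall x : L, x ^+ 2 = 1.

Lemma steinerP (L : loopType) :
  steiner L <-> commutative (@mul L) /\ forall x y : L, x * (x * y) = y.
Proof.
split=> [[ip sq]|[comm sx]].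
- have VK (x y : L) : x * (x * y) = y /\ (y * x) * x = y.
    have [x' x'P] := ip x; have [+ _] := x'P x.
    have -> : x * x = 1 by exact: sq.
    by rewrite mulg1 => e; have := x'P y; rewrite e.
  split=> x y; last by have [] := VK x y.
  have [xz _] := VK x y; have [_ zx] := VK (x * y) x.
  by rewrite xz in zx; rewrite -{2}zx (VK y (x * y)).1.
- split=> x; last by rewrite expg2 -[x in _ * x]mulg1 sx.
  by exists x => y; rewrite [y * x]comm [_ * x]comm sx.
Qed.

Record subloop (L : loopType) := Subloop {
  subloop_set :> set L;
  subloop1 : subloop_set 1;
  subloopM : forall x y, subloop_set x -> subloop_set y ->
    subloop_set (x * y);
  subloop_ldiv : forall x y, subloop_set x -> subloop_set y ->
    subloop_set (ldiv x y);
  subloop_rdiv : forall x y, subloop_set x -> subloop_set y ->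
    subloop_set (rdiv x y)
}.

Definition lcoset (L : loopType) (x : L) (A : set L) : set L :=
  [set x * a | a in A].

Definition rcoset (L : loopType) (A : set L) (x : L) : set L :=
  [set a * x | a in A].

Definition normal (L : loopType) (A : set L) : Prop :=
  forall x y : L,
    [/\ lcoset x A = rcoset A x,
        lcoset x (lcoset y A) = lcoset (x * y) A
      & rcoset (rcoset A x) y = rcoset A (x * y)].

Record normalSubloop (L : loopType) := NormalSubloop {
  normalSubloop_sub :> subloop L;
  normalSubloopP : normal normalSubloop_sub
}.

Definition simple (L : loopType) : Prop :=
  forall N : normalSubloop L,
    (N : set L) = [set 1] \/ (N : set L) = [set: L].

Section SubloopType.
Variables (L : loopType) (S : subloop L).

Definition subloop_type : Type := set_type S.
HB.instance Definition _ := SubChoice.copy subloop_type (set_type S).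

Implicit Types u v : subloop_type.

Definition sub_mul u v : subloop_type :=
  SigSub (mem_set (subloopM (set_valP u) (set_valP v))).
Definition sub_one : subloop_type := SigSub (mem_set (subloop1 S)).
Definition sub_ldiv u v : subloop_type :=
  SigSub (mem_set (subloop_ldiv (set_valP u) (set_valP v))).
Definition sub_rdiv u v : subloop_type :=
  SigSub (mem_set (subloop_rdiv (set_valP u) (set_valP v))).

Lemma sub_mul1g : left_id sub_one sub_mul.
Proof. by move=> u; apply: val_inj; rewrite /= mul1g. Qed.
Lemma sub_mulg1 : right_id sub_one sub_mul.
Proof. by move=> u; apply: val_inj; rewrite /= mulg1. Qed.

HB.instance Definition _ := hasMul.Build subloop_type sub_mul.
HB.instance Definition _ :=
  Magma_isUMagma.Build subloop_type sub_mul1g sub_mulg1.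

Lemma sub_mulKldiv u v : u * sub_ldiv u v = v.
Proof. by apply: val_inj; rewrite /= mulKldiv. Qed.
Lemma sub_ldivKmul u v : sub_ldiv u (u * v) = v.
Proof. by apply: val_inj; rewrite /= ldivKmul. Qed.
Lemma sub_rdivKmul u v : sub_rdiv v u * u = v.
Proof. by apply: val_inj; rewrite /= rdivKmul. Qed.
Lemma sub_mulKrdiv u v : sub_rdiv (v * u) u = v.
Proof. by apply: val_inj; rewrite /= mulKrdiv. Qed.

HB.instance Definition _ := UMagma_isLoop.Build subloop_type
  sub_mulKldiv sub_ldivKmul sub_rdivKmul sub_mulKrdiv.

End SubloopType.

(** The quotient of a loop by a normal subloop: the set of left cosets, with
    setwise multiplication of cosets. *)

Section LoopTheory.
Variable L : loopType.
Implicit Types x y z : L.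

Lemma loop_mulgI x y z : x * y = x * z -> y = z.
Proof. by move=> e; rewrite -(ldivKmul x y) e ldivKmul. Qed.

Lemma loop_mulIg x y z : y * x = z * x -> y = z.
Proof. by move=> e; rewrite -(mulKrdiv x y) e mulKrdiv. Qed.

Lemma lcoset_inj x (A B : set L) : lcoset x A = lcoset x B -> A = B.
Proof.
move=> e; apply/seteqP; split=> a Xa.
- have : lcoset x B (x * a) by rewrite -e; exists a.
  by case=> b Bb /loop_mulgI <-.
- have : lcoset x A (x * a) by rewrite e; exists a.
  by case=> b Bb /loop_mulgI <-.
Qed.

Lemma rcoset_inj x (A B : set L) : rcoset A x = rcoset B x -> A = B.
Proof.
move=> e; apply/seteqP; split=> a Xa.
- have : rcoset B x (a * x) by rewrite -e; exists a.
  by case=> b Bb /loop_mulIg <-.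
- have : rcoset A x (a * x) by rewrite e; exists a.
  by case=> b Bb /loop_mulIg <-.
Qed.

End LoopTheory.

Section Quotient.
Variables (L : loopType) (N : normalSubloop L).
Implicit Types x y z : L.

Definition quotient : Type := set_type (range (fun x => lcoset x N)).
HB.instance Definition _ :=
  SubChoice.copy quotient (set_type (range (fun x => lcoset x N))).

Implicit Types u v w : quotient.

Definition coset x : quotient :=
  SigSub (mem_set (imageT (fun x => lcoset x N) x)).

Lemma coset_surj u : exists x, u = coset x.
Proof. by have [x _ ux] := set_valP u; exists x; apply: val_inj. Qed.

Definition set_mulg (A B : set L) : set L := [set a * b | a in A & b in B].

Lemma lcoset1 : lcoset 1 N = N.
Proof.
apply/seteqP; split=> [_ [a Na <-]|a Na]; first by rewrite mul1g.
by exists a; rewrite ?mul1g.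
Qed.

Lemma lcoset_id x : (N : set L) x -> lcoset x N = N.
Proof.
move=> Nx; apply/seteqP; split=> [_ [a Na <-]|a Na]; first exact: subloopM.
by exists (ldiv x a); [exact: subloop_ldiv | rewrite mulKldiv].
Qed.

Lemma lcoset_mulr x n : (N : set L) n -> lcoset (x * n) N = lcoset x N.
Proof.
move=> Nn; have [_ <- _] := normalSubloopP N x n.
by rewrite (lcoset_id Nn).
Qed.

Lemma set_mulg_coset x y :
  set_mulg (lcoset x N) (lcoset y N) = lcoset (x * y) N.
Proof.
have [eqx exy eyx] := normalSubloopP N x y.
have [eqxy _ _] := normalSubloopP N (x * y) 1.
apply/seteqP; split=> [_ [_ [a Na <-] [_ [b Nb <-] <-]]|_ [a Na <-]].
- have [_ <- _] := normalSubloopP N x y.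
  have : lcoset (x * y) N (x * a * y).
    by rewrite eqxy -eyx -eqx; exists (x * a) => //; exists a.
  case=> m Nm e; rewrite exy -(lcoset_mulr (x * y) Nm) e.
  have [_ <- _] := normalSubloopP N (x * a) y.
  by exists (y * b) => //; exists b.
- have : lcoset (x * y) N (x * y * a) by exists a.
  rewrite -exy => -[c yNc <-]; exists x; last by exists c.
  by exists 1; [exact: subloop1 | rewrite mulg1].
Qed.

Lemma quot_mul_subproof u v :
  range (fun x => lcoset x N) (set_mulg (val u) (val v)).
Proof.
have [x ->] := coset_surj u; have [y ->] := coset_surj v.
by exists (x * y); rewrite ?set_mulg_coset.
Qed.

Definition quot_mul u v : quotient := SigSub (mem_set (quot_mul_subproof u v)).
Definition quot_one : quotient := coset 1.

Lemma quot_mulE x y : quot_mul (coset x) (coset y) = coset (x * y).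
Proof. by apply: val_inj; rewrite /= set_mulg_coset. Qed.

Definition coset_repr u : L := projT1 (cid (coset_surj u)).

Lemma coset_reprK u : coset (coset_repr u) = u.
Proof. by rewrite /coset_repr; case: cid. Qed.

Lemma coset_eq x y : lcoset x N = lcoset y N -> coset x = coset y.
Proof. by move=> e; apply: val_inj. Qed.

Lemma quot_mulI : forall u v w, quot_mul u v = quot_mul u w -> v = w.
Proof.
move=> u v w; rewrite -(coset_reprK u) -(coset_reprK v) -(coset_reprK w).
move: (coset_repr u) (coset_repr v) (coset_repr w) => {u v w} x y z.
rewrite !quot_mulE => /(congr1 val) /= e; apply/coset_eq/(@lcoset_inj _ x).
by have [_ -> _] := normalSubloopP N x y; have [_ -> _] := normalSubloopP N x z.
Qed.

Lemma quot_mulIr : forall u v w, quot_mul v u = quot_mul w u -> v = w.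
Proof.
move=> u v w; rewrite -(coset_reprK u) -(coset_reprK v) -(coset_reprK w).
move: (coset_repr u) (coset_repr v) (coset_repr w) => {u v w} x y z.
rewrite !quot_mulE => /(congr1 val) /= e; apply/coset_eq/(@rcoset_inj _ x).
have [-> _ _] := normalSubloopP N y 1; have [-> _ _] := normalSubloopP N z 1.
have [_ _ ->] := normalSubloopP N y x; have [_ _ ->] := normalSubloopP N z x.
have [<- _ _] := normalSubloopP N (y * x) 1.
by have [<- _ _] := normalSubloopP N (z * x) 1.
Qed.

Definition quot_ldiv u v : quotient :=
  coset (ldiv (coset_repr u) (coset_repr v)).
Definition quot_rdiv u v : quotient :=
  coset (rdiv (coset_repr u) (coset_repr v)).

Lemma quot_mul1g : left_id quot_one quot_mul.
Proof. by move=> u; rewrite -(coset_reprK u) quot_mulE mul1g. Qed.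
Lemma quot_mulg1 : right_id quot_one quot_mul.
Proof. by move=> u; rewrite -(coset_reprK u) quot_mulE mulg1. Qed.

HB.instance Definition _ := hasMul.Build quotient quot_mul.
HB.instance Definition _ :=
  Magma_isUMagma.Build quotient quot_mul1g quot_mulg1.

Lemma quot_mulKldiv u v : u * quot_ldiv u v = v.
Proof.
by rewrite -{1}(coset_reprK u) [LHS]quot_mulE mulKldiv coset_reprK.
Qed.
Lemma quot_ldivKmul u v : quot_ldiv u (u * v) = v.
Proof. by apply: (@quot_mulI u); exact: quot_mulKldiv. Qed.
Lemma quot_rdivKmul u v : quot_rdiv v u * u = v.
Proof.
by rewrite -{2}(coset_reprK u) [LHS]quot_mulE rdivKmul coset_reprK.
Qed.
Lemma quot_mulKrdiv u v : quot_rdiv (v * u) u = v.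
Proof. by apply: (@quot_mulIr u); exact: quot_rdivKmul. Qed.

HB.instance Definition _ := UMagma_isLoop.Build quotient
  quot_mulKldiv quot_ldivKmul quot_rdivKmul quot_mulKrdiv.

End Quotient.

Definition nuclear (L : loopType) (a : L) : Prop :=
  forall x y : L,
    [/\ a * (x * y) = (a * x) * y,
        x * (a * y) = (x * a) * y
      & x * (y * a) = (x * y) * a].

Section Nucleus.
Variable L : loopType.
Implicit Types a b x y : L.

Lemma nuclear1 : nuclear (1 : L).
Proof. by move=> x y; split; rewrite ?(mul1g, mulg1). Qed.

Lemma nuclearM a b : nuclear a -> nuclear b -> nuclear (a * b).
Proof.
move=> Na Nb.
have al x y : a * (x * y) = (a * x) * y by have [] := Na x y.
have am x y : x * (a * y) = (x * a) * y by have [] := Na x y.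
have bl x y : b * (x * y) = (b * x) * y by have [] := Nb x y.
have bm x y : x * (b * y) = (x * b) * y by have [] := Nb x y.
have br x y : x * (y * b) = (x * y) * b by have [] := Nb x y.
have ar x y : x * (y * a) = (x * y) * a by have [] := Na x y.
move=> x y; split.
- by rewrite -al bl al al.
- by rewrite -al am bm am.
- by rewrite !br ar.
Qed.

Lemma nuclearV a : nuclear a ->
  [/\ nuclear (ldiv a 1), a * ldiv a 1 = 1 & ldiv a 1 * a = 1].
Proof.
move=> Na; set a' := ldiv a 1.
have al x y : a * (x * y) = (a * x) * y by have [] := Na x y.
have am x y : x * (a * y) = (x * a) * y by have [] := Na x y.
have ar x y : x * (y * a) = (x * y) * a by have [] := Na x y.
have aa' : a * a' = 1 by rewrite mulKldiv.
have a'a : a' * a = 1 by apply: (@loop_mulgI _ a); rewrite al aa' mul1g mulg1.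
split=> // x y; split.
- by apply: (@loop_mulgI _ a); rewrite 3!al aa' !mul1g.
- rewrite -(mulKldiv a y); set w := ldiv a y.
  by rewrite !am a'a mul1g -ar a'a mulg1.
- by apply: (@loop_mulIg _ a); rewrite -!ar a'a !mulg1.
Qed.

Lemma nuclear_ldiv a b : nuclear a -> nuclear b -> nuclear (ldiv a b).
Proof.
move=> Na Nb; have [Na' aa' _] := nuclearV Na.
suff -> : ldiv a b = ldiv a 1 * b by apply: nuclearM.
apply: (@loop_mulgI _ a); rewrite mulKldiv.
by have [-> _ _] := Na (ldiv a 1) b; rewrite aa' mul1g.
Qed.

Lemma nuclear_rdiv b a : nuclear b -> nuclear a -> nuclear (rdiv b a).
Proof.
move=> Nb Na; have [Na' _ a'a] := nuclearV Na.
suff -> : rdiv b a = b * ldiv a 1 by apply: nuclearM.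
apply: (@loop_mulIg _ a); rewrite rdivKmul.
by have [_ _ <-] := Na b (ldiv a 1); rewrite a'a mulg1.
Qed.

Definition nucleus_sub : subloop L :=
  @Subloop L [set a | nuclear a] nuclear1 nuclearM nuclear_ldiv nuclear_rdiv.

End Nucleus.

Section CLoopNucleus.
Variable C : cloopType.
Implicit Types a x y z : C.

Let inv x : C := rdiv 1 x.

Lemma cloop_LIP x y : inv x * (x * y) = y.
Proof. by rewrite -{1}(mulKldiv x y) cloopE rdivKmul mul1g mulKldiv. Qed.

Lemma cloop_RIP x y : (y * x) * inv x = y.
Proof.
have R z w : (w * z) * ldiv z 1 = w.
  by rewrite -{1}(rdivKmul z w) -cloopE mulKldiv mulg1 rdivKmul.
suff -> : inv x = ldiv x 1 by exact: R.
by rewrite -[LHS](R x) rdivKmul mul1g.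
Qed.

Lemma cloop_invK x : inv (inv x) = x.
Proof. by rewrite -[RHS](cloop_LIP (inv x)) rdivKmul mulg1. Qed.

Lemma cloop_invM x y : inv (x * y) = inv y * inv x.
Proof.
by rewrite -[in RHS](cloop_RIP (x * y) (inv x)) !cloop_LIP.
Qed.

Lemma cloop_sqr_nuclear y : nuclear (y * y).
Proof.
set s := y * y.
have sm x z : x * (s * z) = (x * s) * z.
  rewrite /s; have <- : y * (y * z) = (y * y) * z.
    by have := cloopE 1 y z; rewrite !mul1g.
  rewrite cloopE; congr (_ * _).
  by have := cloopE x y 1; rewrite !mulg1.
have sl p q : s * (p * q) = (s * p) * q.
  have := sm (inv p * inv s) (p * q) ; move/(congr1 (mul (inv (inv p * inv s)))).
  rewrite cloop_LIP.
  have -> : inv p * inv s * s = inv p.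
    by rewrite -{2}(cloop_invK s) cloop_RIP.
  by rewrite cloop_LIP cloop_invM !cloop_invK.
have sr p q : p * (q * s) = (p * q) * s.
  have := sm (p * q) (inv s * inv q).
  move/(congr1 (mul^~ (inv (inv s * inv q)))); rewrite cloop_RIP.
  have -> : s * (inv s * inv q) = inv q.
    by rewrite -{1}(cloop_invK s) cloop_LIP.
  by rewrite cloop_RIP cloop_invM !cloop_invK.
by move=> x z; split.
Qed.

Lemma cloop_conj_nuclear x a : nuclear a -> nuclear ((x * a) * inv x).
Proof.
move=> Na.
have Nxax : nuclear ((x * a) * x).
  have -> : (x * a) * x = rdiv ((x * a) * (x * a)) a.
    by have [_ _ ->] := Na (x * a) x; rewrite mulKrdiv.
  by apply: nuclear_rdiv => //; apply: cloop_sqr_nuclear.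
have Ns := cloop_sqr_nuclear (inv x).
have -> : (x * a) * inv x = ((x * a) * x) * (inv x * inv x).
  have [_ _ <-] := Ns (x * a) x; congr (_ * _).
  by rewrite -{2}(cloop_invK x) cloop_LIP.
exact: nuclearM.
Qed.

Lemma nucleus_normal : normal (nucleus_sub C).
Proof.
move=> x y; split.
- apply/seteqP; split=> _ [a Na <-].
  + exists ((x * a) * inv x); first exact: cloop_conj_nuclear.
    by rewrite -{3}(cloop_invK x) cloop_RIP.
  + have := cloop_conj_nuclear (inv x) Na; rewrite cloop_invK => Nc.
    exists ((inv x * a) * x) => //.
    have [_ <- _] := Na (inv x) x.
    by rewrite -{1}(cloop_invK x) cloop_LIP.
- apply/seteqP; split=> [_ [_ [a Na <-] <-]|_ [a Na <-]].
  + by exists a => //; have [_ _ <-] := Na x y.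
  + exists (y * a); first by exists a.
    by have [_ _ ->] := Na x y.
- apply/seteqP; split=> [_ [_ [a Na <-] <-]|_ [a Na <-]].
  + by exists a => //; have [-> _ _] := Na x y.
  + exists (a * x); first by exists a.
    by have [<- _ _] := Na x y.
Qed.

Definition nucleus : normalSubloop C := NormalSubloop nucleus_normal.

End CLoopNucleus.

Arguments nucleus : clear implicits.

(* Main.v *)
Require Import Defs.
From mathcomp Require Import all_boot.
From mathcomp Require Import boolp classical_sets.

(** Conjugation makes [C] act on its nucleus [N], and [N] acts trivially since
    it is abelian, so the kernel of the action induces a normal subloop of the
    simple loop [Q = C/N].  If the action is trivial then [N] is central; writing
    [x y = (y x) k] with [k] in [N], both [x (y x)] and [(x y) x] equal
    [x^2 y k], because [k^2 = 1].  If the action is faithful then [Q] embeds in a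
    group, so it is a simple elementary abelian 2-group and has at most two
    elements; hence [x] or [y] is nuclear or [y] lies in [x N], and flexibility is
    immediate. *)

Set Implicit Arguments.
Unset Strict Implicit.
Unset Printing Implicit Defensive.

Import Algebra.
Local Open Scope classical_set_scope.
Local Open Scope group_scope.

(** * Congruences of simple loops *)

(* The [iff]s, rather than implications, encode compatibility with divisions. *)
Record congruence (L : loopType) (E : L -> L -> Prop) : Prop := Congruence {
  congr_refl : forall x, E x x;
  congr_sym : forall x y, E x y -> E y x;
  congr_trans : forall y x z, E x y -> E y z -> E x z;
  congr_mull : forall z x y, E (z * x) (z * y) <-> E x y;
  congr_mulr : forall z x y, E (x * z) (y * z) <-> E x y
}.

Section CongruenceClass.
Variables (L : loopType) (E : L -> L -> Prop).
Hypothesis congE : congruence E.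

Let A : set L := [set z | E z 1].

Lemma lcoset_congr (x y : L) :
  lcoset x [set z | E z y] = [set w | E w (x * y)].
Proof.
apply/seteqP; split=> [_ [z Ezy <-]|w /= Ew]; first exact/(congr_mull congE).
exists (ldiv x w); last exact: mulKldiv.
by apply/(congr_mull congE x); rewrite mulKldiv.
Qed.

Lemma rcoset_congr (x y : L) :
  rcoset [set z | E z y] x = [set w | E w (y * x)].
Proof.
apply/seteqP; split=> [_ [z Ezy <-]|w /= Ew]; first exact/(congr_mulr congE).
exists (rdiv w x); last exact: rdivKmul.
by apply/(congr_mulr congE x); rewrite rdivKmul.
Qed.

Lemma congr_class1M x y : A x -> A y -> A (x * y).
Proof.
move=> Ax Ay; apply: (congr_trans congE) Ax.
by rewrite -{2}[x]mulg1; apply/(congr_mull congE).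
Qed.

Lemma congr_class1_ldiv x y : A x -> A y -> A (ldiv x y).
Proof.
move=> Ax Ay; apply/(congr_mull congE x); rewrite mulKldiv mulg1.
exact: congr_trans Ay (congr_sym congE Ax).
Qed.

Lemma congr_class1_rdiv x y : A x -> A y -> A (rdiv x y).
Proof.
move=> Ax Ay; apply/(congr_mulr congE y); rewrite rdivKmul mul1g.
exact: congr_trans Ax (congr_sym congE Ay).
Qed.

Definition congr_class1 : subloop L :=
  Subloop (congr_refl congE 1) congr_class1M congr_class1_ldiv
    congr_class1_rdiv.

Lemma congr_class1_normal : normal congr_class1.
Proof.
by move=> x y; split; rewrite /= !(lcoset_congr, rcoset_congr) ?mulg1 ?mul1g.
Qed.

(** The class of 1 is a normal subloop, and it determines [E]: [E x y] holds exactly when [rdiv x y]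
    lies in it. *)
Lemma simple_congruence : simple L ->
  (forall x y, E x y) \/ (forall x y, E x y -> x = y).
Proof.
move=> /(_ (NormalSubloop congr_class1_normal)) /= [A1|AT]; [right|left].
- move=> x y Exy; have : A (rdiv x y).
    by apply/(congr_mulr congE y); rewrite rdivKmul mul1g.
  by rewrite A1 /= => e; rewrite -(rdivKmul y x) e mul1g.
- have all1 x : E x 1 by rewrite -[E x 1]/(A x) AT.
  by move=> x y; apply: (congr_trans congE) (all1 x) (congr_sym congE (all1 y)).
Qed.

End CongruenceClass.

(** [E] contains the kernel of [f], so its image [E'] in [Q] pulls back to exactly [E] and is a
    congruence of the simple loop [Q]. *)
Lemma simple_congruence_image (L Q : loopType) (f : L -> Q)
    (E : L -> L -> Prop) :
  (forall x y, f (x * y) = f x * f y) -> (forall q, exists x, f x = q) ->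
  (forall x y, f x = f y -> E x y) -> congruence E -> simple Q ->
  (forall x y, E x y) \/ (forall x y, E x y -> f x = f y).
Proof.
move=> fM fS fE congE sQ.
pose E' p q := exists x y, [/\ f x = p, f y = q & E x y].
have E'P x y : E' (f x) (f y) <-> E x y.
  split=> [[x1 [y1 [fx fy Exy]]]|Exy]; last by exists x; exists y.
  apply: (congr_trans congE (fE _ _ (esym fx))).
  exact: congr_trans Exy (fE _ _ fy).
have congE' : congruence E'.
  split.
  - by move=> p; have [x <-] := fS p; exact/E'P/(congr_refl congE).
  - move=> p q; have [x <-] := fS p; have [y <-] := fS q.
    by move=> /E'P /(congr_sym congE) /E'P.
  - move=> q p r; have [x <-] := fS p; have [y <-] := fS q.
    have [z <-] := fS r => /E'P Exy /E'P Eyz.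
    exact/E'P/(congr_trans congE Exy Eyz).
  - move=> r p q; have [x <-] := fS p; have [y <-] := fS q.
    by have [z <-] := fS r; rewrite -!fM !E'P; apply: congr_mull.
  - move=> r p q; have [x <-] := fS p; have [y <-] := fS q.
    by have [z <-] := fS r; rewrite -!fM !E'P; apply: congr_mulr.
have [all|triv] := simple_congruence congE' sQ; [left|right] => x y.
  exact/E'P/all.
by move=> /E'P /triv.
Qed.

(** An associative Steiner loop is an elementary abelian 2-group; [E] is congruence modulo the
    subgroup formed by 1 and [q], which simplicity forces to be all of [Q]. *)
Lemma simple_steiner_assoc (Q : loopType) : steiner Q -> simple Q ->
  associative (@mul Q) -> forall q p : Q, q <> 1 -> p = 1 \/ p = q.
Proof.
move=> /steinerP [mulC mulK] sQ mulA q p q1.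
pose E (x y : Q) := x = y \/ x = q * y.
have congE : congruence E.
  split.
  - by left.
  - by move=> x y [->|->]; [left|right; rewrite mulK].
  - by move=> y x z [->|->] [->|->]; rewrite /E ?mulK; auto.
  - move=> z x y; split=> [[/loop_mulgI ->|]|[->|->]]; try by left.
      by rewrite mulA (mulC q) -mulA => /loop_mulgI ->; right.
    by right; rewrite mulA (mulC z) -mulA.
  - move=> z x y; split=> [[/loop_mulIg ->|]|[->|->]]; try by left.
      by rewrite mulA => /loop_mulIg ->; right.
    by right; rewrite mulA.
have [all|triv] := simple_congruence congE sQ.
  by have [->|->] := all p 1; [left|right; rewrite mulg1].
by case: q1; apply: triv; right; rewrite mulg1.
Qed.

(** * Conjugation action on the nucleus *)

Section Conjugation.
Variable C : cloopType.
Hypothesis nuclC : forall a b : C, nuclear a -> nuclear b -> a * b = b * a.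
Implicit Types a b x y z : C.

Definition cloop_conj x a : C := (x * a) * rdiv 1 x.

Lemma cloop_conjE x a : cloop_conj x a * x = x * a.
Proof.
by have := cloop_RIP (rdiv 1 x) (x * a); rewrite cloop_invK.
Qed.

Lemma cloop_conjP x a b : b * x = x * a -> cloop_conj x a = b.
Proof. by move=> e; apply: (@loop_mulIg _ x); rewrite cloop_conjE. Qed.

(** Although [C] need not be associative, every reassociation here is around a nuclear element: [a]
    or one of its conjugates. *)
Lemma cloop_conjM x y a : nuclear a ->
  cloop_conj (x * y) a = cloop_conj x (cloop_conj y a).
Proof.
move=> Na; have Nya := cloop_conj_nuclear y Na.
have Nxya := cloop_conj_nuclear x Nya.
apply: cloop_conjP; have [-> _ _] := Nxya x y; rewrite cloop_conjE.
by have [_ <- _] := Nya x y; rewrite cloop_conjE; have [_ _ ->] := Na x y.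
Qed.

(** The kernel of the conjugation action, as a relation on [C]. *)
Definition same_conj x y := forall a, nuclear a -> cloop_conj x a = cloop_conj y a.

Lemma same_conj_congruence : congruence same_conj.
Proof.
split.
- by move=> x a _.
- by move=> x y exy a Na; rewrite exy.
- by move=> y x z exy eyz a Na; rewrite exy ?eyz.
- move=> z x y; split=> e a Na; last by rewrite !cloop_conjM ?e.
  have := e a Na; rewrite !cloop_conjM // => /(congr1 (mul^~ z)) /=.
  by rewrite !cloop_conjE => /loop_mulgI.
- move=> z x y; split=> e a Na.
    (* Conjugation by [z] maps the nucleus onto itself: [a] is the conjugate by [z] of
       [cloop_conj (rdiv 1 z) a], to which the hypothesis is applied. *)
    have Nza := cloop_conj_nuclear (rdiv 1 z) Na.
    have := e _ Nza; rewrite !cloop_conjM //.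
    suff -> : cloop_conj z (cloop_conj (rdiv 1 z) a) = a by [].
    rewrite -cloop_conjM //; apply: cloop_conjP.
    suff -> : z * rdiv 1 z = 1 by rewrite mul1g mulg1.
    by have := cloop_RIP z 1; rewrite mul1g.
  rewrite !cloop_conjM //; apply: e; exact: cloop_conj_nuclear.
Qed.

(** Nuclear elements act trivially because the nucleus is commutative. *)
Lemma same_conj_mulr_nuclear x n : nuclear n -> same_conj x (x * n).
Proof.
move=> Nn a Na; rewrite cloop_conjM //; congr cloop_conj.
by apply/esym/cloop_conjP; rewrite nuclC.
Qed.

End Conjugation.

(** * Sufficient conditions for flexibility *)

Lemma nuclear_flexible (L : loopType) (x y : L) :
  nuclear x \/ nuclear y -> x * (y * x) = (x * y) * x.
Proof. by case=> N; have [E1 E2 E3] := N y x; have [_ F2 _] := N x x. Qed.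

Lemma cloop_lalt (C : cloopType) (x y : C) : x * (x * y) = (x * x) * y.
Proof. by have := cloopE 1 x y; rewrite !mul1g. Qed.

Lemma cloop_ralt (C : cloopType) (x y : C) : (y * x) * x = y * (x * x).
Proof. by have := cloopE y x 1; rewrite !mulg1. Qed.

Lemma cloop_mulr_nuclear_flexible (C : cloopType) (x n : C) : nuclear n ->
  x * ((x * n) * x) = (x * (x * n)) * x.
Proof.
move=> Nn; have [_ <- _] := Nn x x.
by rewrite !cloop_lalt; have [_ -> _] := Nn (x * x) x.
Qed.

(** The alternative laws turn the two sides into [((x * x) * y) * k] and [(y * (x * x)) * k]; these
    agree because squares in a C-loop are nuclear, hence central here. *)
Lemma cloop_central_flexible (C : cloopType) (x y k : C) :
  (forall a z : C, nuclear a -> a * z = z * a) ->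
  nuclear k -> k * k = 1 -> x * y = (y * x) * k ->
  x * (y * x) = (x * y) * x.
Proof.
move=> cen Nk kk xy.
have kxy : y * x = (x * y) * k.
  by rewrite xy; have [_ _ <-] := Nk (y * x) k; rewrite kk mulg1.
rewrite {1}kxy; have [_ _ ->] := Nk x (x * y); rewrite cloop_lalt.
rewrite xy; have [_ <- _] := Nk (y * x) x; rewrite (cen k x) //.
have [_ _ ->] := Nk (y * x) x; rewrite cloop_ralt.
by rewrite (cen _ y) //; apply: cloop_sqr_nuclear.
Qed.

(** * The nucleus and its cosets *)

Section NucleusQuotient.
Variable C : cloopType.

Lemma coset_nucleus (x y : C) : coset (nucleus C) x = coset (nucleus C) y <->
  exists2 n, nuclear n & y = x * n.
Proof.
split=> [/(congr1 val) /= e|[n Nn ->]].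
  have : lcoset x (nucleus C) y.
    by rewrite e; exists 1; [exact: nuclear1|rewrite mulg1].
  by case=> n Nn <-; exists n.
by apply/coset_eq; rewrite lcoset_mulr.
Qed.

Lemma nucleus_elementary_abelian2 (K : groupType) : elementary_abelian2 K ->
  isomorphic (subloop_type (nucleus C)) K ->
  (forall a b : C, nuclear a -> nuclear b -> a * b = b * a) /\
  (forall a : C, nuclear a -> a * a = 1).
Proof.
move=> [Kc K2] [f /bij_inj f_inj].
pose F a (Na : nuclear a) : subloop_type (nucleus C) := SigSub (mem_set Na).
(* Only products are assumed preserved by [f], but [f 1] is its own square, and squares in [K] are
   trivial. *)
have f1 : f 1 = 1 by rewrite -[1 in LHS]mul1g gmulfM; apply: K2.
split=> [a b Na Nb|a Na].
  have /(congr1 val) : F a Na * F b Nb = F b Nb * F a Na; last by [].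
  by apply: f_inj; rewrite !gmulfM; apply: Kc.
have /(congr1 val) : F a Na * F a Na = 1; last by [].
by apply: f_inj; rewrite gmulfM f1; apply: K2.
Qed.

End NucleusQuotient.

Theorem corollary5p10 (K : groupType) (Q : loopType) :
  elementary_abelian2 K -> steiner Q -> simple Q ->
  ~ exists C : cloopType,
      [/\ ~ flexible C,
          isomorphic (subloop_type (nucleus C)) K
        & isomorphic (quotient (nucleus C)) Q].
Proof.
move=> abK stQ sQ [C [nflex isoK [f f_bij]]]; apply: nflex => x y.
have [nuclC nucl2] := nucleus_elementary_abelian2 abK isoK.
pose g z := f (coset (nucleus C) z).
have gM u v : g (u * v) = g u * g v.
  by rewrite /g -gmulfM; congr (f _); rewrite -[LHS]quot_mulE.
have gS q : exists u, g u = q.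
  have [h _ hK] := f_bij; have [u hu] := coset_surj (h q).
  by exists u; rewrite /g -hu hK.
have gN u v : g u = g v -> exists2 n, nuclear n & v = u * n.
  by move/(bij_inj f_bij)/coset_nucleus.
have gE u v : g u = g v -> same_conj u v.
  by move=> /gN [n Nn ->]; apply: same_conj_mulr_nuclear.
have g1 : g 1 = 1.
  by apply: (@loop_mulgI _ (g 1)); rewrite -gM !mulg1.
have nucl_g1 z : g z = 1 -> nuclear z.
  by rewrite -g1 => /esym /gN [n Nn ->]; rewrite mul1g.
have [mulC _] := (steinerP Q).1 stQ.
have [all|faithful] :=
  simple_congruence_image gM gS gE (same_conj_congruence C) sQ.
(* Trivial action: [Q] is commutative, so [x * y] and [y * x] differ by a nuclear [k]. *)
- have [|k Nk xyk] := gN (y * x) (x * y); first by rewrite !gM mulC.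
  apply: cloop_central_flexible Nk (nucl2 k Nk) xyk => a z Na.
  have <- := cloop_conjE z a; rewrite (all z 1) //; congr (_ * _).
  by apply/esym/cloop_conjP; rewrite mul1g mulg1.
(* Faithful action: both bracketings of [u], [v], [w] act as the same composite of three
   conjugations. *)
- have mulA : associative (@mul Q).
    move=> p q r; have [u <-] := gS p; have [v <-] := gS q.
    have [w <-] := gS r; rewrite -!gM; apply: faithful => a Na.
    rewrite !cloop_conjM //; exact: cloop_conj_nuclear.
  have [gx1|gx1] := pselect (g x = 1).
    by apply: nuclear_flexible; left; apply: nucl_g1.
  (* Now [Q] consists of 1 and [g x] only. *)
  have [gy|gy] := simple_steiner_assoc stQ sQ mulA (g y) gx1.
    by apply: nuclear_flexible; right; apply: nucl_g1.
  have [n Nn ->] := gN x y (esym gy).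
  exact: cloop_mulr_nuclear_flexible.
Qed.
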